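(* Let $A\in\mathbb{C}^{n\times n}$ have index $k$ and let $m$ be a positive integer. Then the following statements hold: (a) $A^{\mathrm{w}_m,\dagger}=(A^D)^{m+1}P_{A^k}A^mP_A$; (b) if $k\ge m$, then $A^{\mathrm{w}_m,\dagger}=A^{k-m}(A^{k+1})^{\mathrm{core}}A^mP_A$; (c) if $k\ge m+1$, then $A^{\mathrm{w}_m,\dagger}=(A^k)^{\#}A^{k-m-1}P_{A^k}A^mP_A$; (d) $A^{\mathrm{w}_m,\dagger}=(A^{m+1}P_{A^k})^\dagger A^mP_A$; (e) $A^{\mathrm{w}_m,\dagger}=A^{m-1}P_{A^k}(A^m)^{\mathrm{w}}P_A$.
   Context: $r(\cdot)$ and $\mathcal{R}(\cdot)$ denote rank and range; $B^\dagger$ is the Moore-Penrose inverse, $B^D$ the Drazin inverse, $B^{\#}$ the group inverse (of a matrix of index at most $1$), and $P_B=BB^\dagger$ the orthogonal projector onto $\mathcal{R}(B)$. The index of $A\in\mathbb{C}^{n\times n}$ is the smallest nonnegative integer $k$ with $r(A^{k+1})=r(A^k)$ (with $A^0=I_n$). For a matrix $B$ of index at most $1$, $B^{\mathrm{core}}$ denotes its core inverse: the unique $X$ with $BX=P_B$ and $\mathcal{R}(X)\subseteq\mathcal{R}(B)$. For a square matrix $B$ of index $q$, the core-EP inverse is $B^{\mathrm{cEP}}=B^DB^q(B^q)^\dagger$, the weak group inverse is $B^{\mathrm{w}}=(B^{\mathrm{cEP}})^2B$, and the $m$-weak group inverse is $B^{\mathrm{w}_m}=(B^{\mathrm{cEP}})^{m+1}B^m$.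 The $m$-weak group MP inverse $A^{\mathrm{w}_m,\dagger}$ is the unique $X\in\mathbb{C}^{n\times n}$ satisfying $XAX=X$, $AX=A_1A^\dagger$ and $XA=A^DA_1$, where $A_1=AA^{\mathrm{w}_m}A$. *)

(* Defs.v *)
From HB Require Import structures.
From mathcomp Require Import all_boot all_order all_algebra.
From mathcomp Require Import boolp classical_sets reals.
From mathcomp Require Import complex.

Set Implicit Arguments.
Unset Strict Implicit.
Unset Printing Implicit Defensive.

Import Order.TTheory GRing.Theory Num.Theory.
Local Open Scope classical_set_scope.
Local Open Scope ring_scope.
Local Open Scope sesquilinear_scope.

(* Each generalized inverse below is characterized by a predicate, and the
   inverse itself is [xget 0] of that predicate: the (unique) solution when
   there is one, and the junk value 0 otherwise, which only happens for the
   group and core inverses of a matrix of index greater than 1. *)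

Section GeneralizedInverses.
Variable C : numClosedFieldType.

Section Index.
Variables (n : nat) (A : 'M[C]_n).

Lemma mxindex_exists : exists k, \rank (A ^+ k.+1) == \rank (A ^+ k).
Proof.
apply: contrapT => /forallNP rankNeq.
have rank_lt k : (\rank (A ^+ k.+1) < \rank (A ^+ k))%N.
  by rewrite ltn_neqAle exprS mxrankM_maxr -exprS andbT; apply/negP.
have rank_le k : (\rank (A ^+ k) + k <= n)%N.
  elim: k => [|k IHk]; first by rewrite addn0 rank_leq_row.
  by rewrite addnS (leq_trans _ IHk)// -addSn leq_add2r.
by have := leq_trans (leq_addl _ _) (rank_le n.+1); rewrite ltnn.
Qed.

Definition mxindex : nat := ex_minn mxindex_exists.

End Index.

Definition is_mpinv m n (B : 'M[C]_(m, n)) (X : 'M[C]_(n, m)) : Prop :=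
  [/\ B *m X *m B = B, X *m B *m X = X,
      (B *m X)^t* = B *m X & (X *m B)^t* = X *m B].

Definition mpinv m n (B : 'M[C]_(m, n)) : 'M[C]_(n, m) :=
  xget 0 [set X | is_mpinv B X].

Definition rangeproj m n (B : 'M[C]_(m, n)) : 'M[C]_m := B *m mpinv B.

Section Square.
Variable n : nat.
Implicit Types A B X : 'M[C]_n.

Definition is_drazin B X : Prop :=
  [/\ X *m B *m X = X, B *m X = X *m B
    & B ^+ (mxindex B).+1 *m X = B ^+ mxindex B].

Definition drazin B : 'M[C]_n := xget 0 [set X | is_drazin B X].

Definition is_groupinv B X : Prop :=
  [/\ B *m X *m B = B, X *m B *m X = X & B *m X = X *m B].

Definition groupinv B : 'M[C]_n := xget 0 [set X | is_groupinv B X].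

(* Ranges are column spaces, but [(_ <= _)%MS] compares row spaces. *)
Definition is_coreinv B X : Prop :=
  B *m X = rangeproj B /\ (X^T <= B^T)%MS.

Definition coreinv B : 'M[C]_n := xget 0 [set X | is_coreinv B X].

Definition cepinv B : 'M[C]_n :=
  let q := mxindex B in drazin B *m B ^+ q *m mpinv (B ^+ q).

Definition wginv B : 'M[C]_n := cepinv B ^+ 2 *m B.

Definition mwginv (m : nat) B : 'M[C]_n := cepinv B ^+ m.+1 *m B ^+ m.

Definition is_mwgmpinv (m : nat) A X : Prop :=
  let A1 := A *m mwginv m A *m A in
  [/\ X *m A *m X = X, A *m X = A1 *m mpinv A & X *m A = drazin A *m A1].

Definition mwgmpinv (m : nat) A : 'M[C]_n := xget 0 [set X | is_mwgmpinv m A X].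

End Square.

End GeneralizedInverses.

(* Main.v *)
Require Import Defs.
From mathcomp Require Import all_boot all_order all_algebra.
From mathcomp Require Import classical_sets reals complex.

Import Order.TTheory GRing.Theory Num.Theory.
Local Open Scope ring_scope.

(** Write [D] for the Drazin inverse of [A], [k] for its index and [P] for the
    orthogonal projector onto the range of [A ^+ k].  On that range [A] is
    invertible, [D] is its inverse there, and the range of [D] lies in it.
    Everything follows from three consequences.

    - [P] is absorbed on the left by [D ^+ i * P], and powers of [A] cancel
      against powers of [D] in front of [P]
      ([coreproj_drazinX], [powA_drazinX_coreproj]).
    - For [j >= k] the range of [A ^+ j] does not depend on [j], hence neither
      does its orthogonal projector ([rangeproj_pow]).
    - The core-EP inverse of [A] is [D * P], and in its powers the inner
      factors [P] disappear, leaving [D ^+ i.+1 * P] ([cepinv_pow]).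

    By the third one the m-weak group inverse is [D ^+ m.+1 * P * A ^+ m];
    multiplied by [rangeproj A] it satisfies the three equations that define
    the m-weak group MP inverse, and these have at most one solution
    ([mwgmpinvE]).  This is (a).  Each other formula reduces to it once one
    more generalized inverse is known in terms of [D] and [P]: the core inverse
    of [A ^+ k.+1] is [D ^+ k.+1 * P] ([coreinv_powA]), the group inverse of
    [A ^+ k] is [D ^+ k] ([groupinv_powA]), the Moore-Penrose inverse of
    [A ^+ m.+1 * P] is [D ^+ m.+1 * P] ([mpinv_powA_coreproj]), and the core-EP
    inverse of [A ^+ m] is [D ^+ m * P] ([cepinv_powA]).

    The generalized inverses are chosen among the solutions of a predicate, so
    a solution has to be exhibited: a full-rank factorization gives the
    Moore-Penrose inverse, and [A ^+ k * G * A ^+ k], with [G] an inner inverse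
    of [A ^+ (2 k + 1)], is the Drazin inverse. *)

(** * Moore-Penrose inverses and orthogonal projectors *)

Section MoorePenrose.
Set Implicit Arguments.
Unset Strict Implicit.
Variable C : numClosedFieldType.
Local Open Scope sesquilinear_scope.

Lemma trmxC_mul m n p (B : 'M[C]_(m, n)) (E : 'M[C]_(n, p)) :
  (B *m E)^t* = E^t* *m B^t*.
Proof. by rewrite trmx_mul map_mxM. Qed.

Lemma trmxC_inv n (B : 'M[C]_n) : (invmx B)^t* = invmx (B^t* ).
Proof. by rewrite trmx_inv map_invmx. Qed.

(** A row vector [u] killed by [G *m G^t*] makes [u *m G] orthogonal to
    itself. *)
Lemma gram_unit {r n} (G : 'M[C]_(r, n)) :
  row_free G -> G *m G^t* \in unitmx.
Proof.
move=> Gfree; rewrite -row_free_unit -kermx_eq0; apply/rowV0P => u.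
move=> /sub_kermxP uGG0; apply/eqP.
rewrite -(mulmx_free_eq0 _ Gfree); apply: contraT => uG_neq0.
have := dotmx_is_dotmx uG_neq0.
by rewrite dotmxE trmxC_mul mulmxA -(mulmxA u) uGG0 mul0mx mxE ltxx.
Qed.

(** The product of [F *m G] with this matrix is, on one side, the orthogonal
    projector onto the column space of [F], and on the other side the one onto
    the row space of [G]; [gram_unit] makes both Gram matrices invertible. *)
Lemma is_mpinv_full_rank m r n (F : 'M[C]_(m, r)) (G : 'M[C]_(r, n)) :
  row_free (F^t* ) -> row_free G ->
  is_mpinv (F *m G)
    (G^t* *m invmx (G *m G^t*) *m (invmx (F^t* *m F) *m F^t*)).
Proof.
move=> Ffree Gfree.
have unitGG := gram_unit Gfree.
have unitFF : F^t* *m F \in unitmx by rewrite -{2}(trmxCK F) gram_unit.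
set H := G *m G^t* in unitGG *; set K := F^t* *m F in unitFF *.
have HC : H^t* = H by rewrite trmxC_mul trmxCK.
have KC : K^t* = K by rewrite trmxC_mul trmxCK.
set X := G^t* *m invmx H *m (invmx K *m F^t*).
have BX : F *m G *m X = F *m invmx K *m F^t*.
  by rewrite /X !mulmxA -(mulmxA F G) -/H mulmxK.
have XB : X *m (F *m G) = G^t* *m invmx H *m G.
  by rewrite /X !mulmxA -(mulmxA _ (F^t* ) F) -/K mulmxKV.
split.
- by rewrite BX !mulmxA -(mulmxA _ (F^t* ) F) -/K mulmxKV.
- by rewrite XB /X !mulmxA -(mulmxA _ G) -/H mulmxKV.
- by rewrite BX !trmxC_mul trmxCK trmxC_inv KC mulmxA.
- by rewrite XB !trmxC_mul trmxCK trmxC_inv HC mulmxA.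
Qed.

Lemma mpinv_exists m n (B : 'M[C]_(m, n)) : exists X, is_mpinv B X.
Proof.
rewrite -(mulmx_base B); eexists; apply: is_mpinv_full_rank.
  by rewrite /row_free mxrank_map mxrank_tr (eqnP (col_base_full B)).
exact: row_base_free.
Qed.

Lemma mpinvP {m n} (B : 'M[C]_(m, n)) : is_mpinv B (mpinv B).
Proof. exact: (xgetPex 0 (mpinv_exists B)). Qed.

Lemma rangeproj_mul {m n} (B : 'M[C]_(m, n)) : rangeproj B *m B = B.
Proof. by case: (mpinvP B). Qed.

(** The adjoint of [P *m Q = Q] is [Q *m P = Q].  This is why an orthogonal
    projector is determined by its range. *)
Lemma hermitian_absorb_eq n (P Q : 'M[C]_n) :
  P^t* = P -> Q^t* = Q -> P *m Q = Q -> Q *m P = P -> P = Q.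
Proof. by move=> PC QC PQ <-; rewrite -PC -{1}QC -trmxC_mul PQ. Qed.

Lemma rangeproj_eq m n p (B : 'M[C]_(m, n)) (E : 'M[C]_(m, p)) Y Z :
  B = E *m Y -> E = B *m Z -> rangeproj B = rangeproj E.
Proof.
move=> BE EB; have [_ _ PC _] := mpinvP B; have [_ _ QC _] := mpinvP E.
have PE : rangeproj B *m E = E by rewrite {1}EB mulmxA rangeproj_mul -EB.
have QB : rangeproj E *m B = B by rewrite {1}BE mulmxA rangeproj_mul -BE.
by apply: hermitian_absorb_eq => //; rewrite mulmxA ?PE ?QB.
Qed.

(** Two Moore-Penrose inverses [X], [Y] give [B *m X] and [B *m Y] the same
    range, and [X *m B] and [Y *m B] the same kernel, so these projectors agree;
    then [Y = X *m B *m Y = X *m B *m X = X]. *)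
Lemma mpinv_unique m n (B : 'M[C]_(m, n)) X : is_mpinv B X -> mpinv B = X.
Proof.
case: (mpinvP B); set Y := mpinv B => BYB YBY BYC YBC.
case=> BXB XBX BXC XBC.
have BXY : B *m X = B *m Y.
  by apply: hermitian_absorb_eq; rewrite // mulmxA ?BXB ?BYB.
have XYB : X *m B = Y *m B.
  rewrite -XBC -{1}BYB -(mulmxA B Y) mulmxA trmxC_mul XBC YBC.
  by rewrite mulmxA -(mulmxA Y B X) -(mulmxA Y) BXB.
by rewrite -YBY -XYB -mulmxA -BXY mulmxA XBX.
Qed.

End MoorePenrose.

(** * Drazin inverses *)

Section Drazin.
Set Implicit Arguments.
Unset Strict Implicit.
Variables (C : numClosedFieldType) (n : nat).
Implicit Types A X : 'M[C]_n.

Lemma mxindex_rank A : \rank (A ^+ (mxindex A).+1) = \rank (A ^+ mxindex A).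
Proof. by apply/eqP; rewrite /mxindex; case: ex_minnP. Qed.

Lemma mxindex_min A k : \rank (A ^+ k.+1) = \rank (A ^+ k) -> (mxindex A <= k)%N.
Proof. by rewrite /mxindex; case: ex_minnP => q _ qmin /eqP /qmin. Qed.

Lemma powS_row_factor A : exists Y, A ^+ mxindex A = Y *m A ^+ (mxindex A).+1.
Proof.
apply/submxP; rewrite exprS -(geq_leqif (mxrank_leqif_sup (submxMl A _))).
by rewrite mulmxE -exprS mxindex_rank.
Qed.

Lemma powS_col_factor A : exists Z, A ^+ mxindex A = A ^+ (mxindex A).+1 *m Z.
Proof.
have: ((A ^+ mxindex A)^T <= (A ^+ (mxindex A).+1)^T)%MS.
  rewrite exprSr -mulmxE trmx_mul -(geq_leqif (mxrank_leqif_sup (submxMl _ _))).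
  by rewrite -trmx_mul mulmxE -exprSr !mxrank_tr mxindex_rank.
case/submxP => Z /(canRL (@trmxK _ _ _)) ->; exists Z^T.
by rewrite trmx_mul trmxK.
Qed.

Lemma pow_row_factor A j : exists Y, A ^+ mxindex A = Y * A ^+ (mxindex A + j).
Proof.
have [Y AY] := powS_row_factor A; exists (Y ^+ j).
elim: j => [|j IHj]; first by rewrite addn0 mul1r.
by rewrite addnS -addSn exprSr exprD mulrA -(mulrA _ Y) -[Y * _]AY -mulrA -exprD.
Qed.

Lemma pow_col_factor A j : exists Z, A ^+ mxindex A = A ^+ (mxindex A + j) * Z.
Proof.
have [Z AZ] := powS_col_factor A; exists (Z ^+ j).
elim: j => [|j IHj]; first by rewrite addn0 mulr1.
rewrite addnS -addSn addnC exprD (exprS Z) !mulrA -(mulrA _ _ Z) -[_ * Z]AZ.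
by rewrite -exprD addnC.
Qed.

(** Write [A ^+ k = Y * A ^+ (2 k + 1) = A ^+ (2 k + 1) * Z] and take [G] an inner
    inverse of [A ^+ (2 k + 1)].  Then [A ^+ k * G * A ^+ k] works:
    [G] disappears from its products with [A], which are
    [Y * A ^+ k.+1] and [A ^+ k.+1 * Z]; these are equal. *)
Lemma drazin_exists A : exists X, is_drazin A X.
Proof.
set k := mxindex A; set N := (k + k.+1)%N; set G := mpinv (A ^+ N).
have [Y AY] := pow_row_factor A k.+1; have [Z AZ] := pow_col_factor A k.+1.
have AGA : A ^+ N * G * A ^+ N = A ^+ N by case: (mpinvP (A ^+ N)).
rewrite -/k -/N in AY AZ.
have AGAk : A ^+ N * G * A ^+ k = A ^+ k by rewrite {1}AZ mulrA AGA -AZ.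
have AkGA : A ^+ k * G * A ^+ N = A ^+ k.
  by rewrite {1}AY -!mulrA (mulrA _ G) AGA -AY.
pose X := A ^+ k * G * A ^+ k.
have AkSY : A ^+ k.+1 = Y * A * A ^+ N.
  by rewrite exprSr AY -mulrA -exprSr exprS mulrA.
have AkSZ : A ^+ k.+1 = A ^+ N * A * Z.
  by rewrite exprS AZ mulrA -exprS exprSr.
have AX : A * X = Y * A ^+ k.+1.
  rewrite /X !mulrA -exprS {1}AkSY -2!mulrA (mulrA _ G).
  by rewrite AGAk -mulrA -exprS.
have XA : X * A = A ^+ k.+1 * Z.
  by rewrite /X -mulrA -exprSr {1}AkSZ !mulrA AkGA -exprSr.
exists X; rewrite /is_drazin !mulmxE -/k; split.
- have XAk : X * A * A ^+ k = A ^+ k.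
    by rewrite -mulrA -exprS -mulrA -exprD AkGA.
  by rewrite {2}/X !mulrA XAk.
- by rewrite AX XA {1}AkSZ !mulrA -AY -exprSr.
- by rewrite /X !mulrA -exprD addSnnS AGAk.
Qed.

Lemma drazinP A : is_drazin A (drazin A).
Proof. exact: (xgetPex 0 (drazin_exists A)). Qed.

End Drazin.

(** * The core part of a matrix *)

Section CorePart.
Set Implicit Arguments.
Unset Strict Implicit.
Variables (C : numClosedFieldType) (n : nat) (A : 'M[C]_n).
Local Notation k := (mxindex A).
Local Notation D := (drazin A).

(* [P] is kept abstract so that the product defining [rangeproj] stays closed
   under reassociation. *)
Variable P : 'M[C]_n.
Hypothesis defP : P = rangeproj (A ^+ k).

Lemma coreprojE : P = A ^+ k * mpinv (A ^+ k).
Proof. exact: defP. Qed.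

Lemma coreproj_range : P * A ^+ k = A ^+ k.
Proof. by rewrite defP; apply: rangeproj_mul. Qed.

Lemma comm_drazinX i j : A ^+ i * D ^+ j = D ^+ j * A ^+ i.
Proof. by apply/commrX/commr_sym/commrX/commr_sym; case: (drazinP A). Qed.

Lemma powA_drazinX j i : A ^+ j * D ^+ (j + i.+1) = D ^+ i.+1.
Proof.
have ADD : A * (D * D) = D.
  by case: (drazinP A) => + + _; rewrite !mulmxE mulrA => + ->.
elim: j => [|j IHj]; first exact: mul1r.
by rewrite exprSr -mulrA addSn addnS 2!exprS !mulrA -(mulrA _ A) -(mulrA _ _ D)
           -mulrA -(mulrA A) ADD -exprS -addnS IHj.
Qed.

Lemma powA_mul_drazinX j i : (k <= j)%N -> A ^+ (j + i) * D ^+ i = A ^+ j.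
Proof.
move=> le_kj; elim: i => [|i IHi]; first by rewrite addn0 mulr1.
have AkD : A ^+ k.+1 * D = A ^+ k by case: (drazinP A).
rewrite -[RHS]IHi exprS mulrA; congr (_ * _).
by rewrite addnS -(subnK le_kj) addnAC -addnS exprD -mulrA AkD -exprD.
Qed.

Lemma drazinX_powA i j : (k <= j)%N -> A ^+ i * D ^+ i * A ^+ j = A ^+ j.
Proof.
by move=> le_kj; rewrite -mulrA -comm_drazinX mulrA -exprD addnC powA_mul_drazinX.
Qed.

Lemma powA_drazinX_coreproj j i : A ^+ j * (D ^+ (j + i) * P) = D ^+ i * P.
Proof.
have fixP : A ^+ j * D ^+ j * P = P.
  by rewrite coreprojE mulrA drazinX_powA.
by rewrite addnC exprD !mulrA comm_drazinX -2!(mulrA (D ^+ i)) fixP.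
Qed.

Lemma powA_drazinX_cancel i : A ^+ i * (D ^+ i * P) = P.
Proof. by have := powA_drazinX_coreproj i 0; rewrite addn0 mul1r. Qed.

Lemma drazinX_powA_cancel i : D ^+ i * (A ^+ i * P) = P.
Proof. by rewrite mulrA -comm_drazinX -mulrA powA_drazinX_cancel. Qed.

Lemma coreproj_idem : P * P = P.
Proof. by rewrite {2}coreprojE mulrA coreproj_range -coreprojE. Qed.

(** A matrix [X] commuting with [A ^+ k] preserves the range of [A ^+ k]. *)
Lemma coreproj_comm X : A ^+ k * X = X * A ^+ k -> P * (X * P) = X * P.
Proof.
by move=> kX; rewrite [in X * _]coreprojE (mulrA X) -kX !mulrA coreproj_range.
Qed.

Lemma coreproj_drazinX i : P * (D ^+ i * P) = D ^+ i * P.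
Proof. by rewrite coreproj_comm // comm_drazinX. Qed.

Lemma coreproj_powA i : P * (A ^+ i * P) = A ^+ i * P.
Proof. by rewrite coreproj_comm // -!exprD addnC. Qed.

Lemma rangeproj_pow j : (k <= j)%N -> rangeproj (A ^+ j) = P.
Proof.
rewrite defP => le_kj; have [Z AZ] := pow_col_factor A (j - k).
apply: (@rangeproj_eq _ _ _ _ _ _ (A ^+ (j - k)) Z).
  by rewrite mulmxE -exprD subnKC.
by rewrite mulmxE {1}AZ subnKC.
Qed.

Lemma cepinvE : cepinv A = D * P.
Proof. by rewrite /cepinv -mulmxA defP. Qed.

Lemma cepinv_pow i : cepinv A ^+ i.+1 = D ^+ i.+1 * P.
Proof.
elim: i => [|i IHi]; first by rewrite cepinvE.
by rewrite exprS IHi cepinvE -mulrA coreproj_drazinX mulrA -exprS.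
Qed.

(** The products of the two matrices, in both orders, are the Hermitian
    matrix [P]. *)
Lemma mpinv_powA_coreproj i : mpinv (A ^+ i * P) = D ^+ i * P.
Proof.
have AD : A ^+ i * P * (D ^+ i * P) = P.
  by rewrite -mulrA coreproj_drazinX powA_drazinX_cancel.
have DA : D ^+ i * P * (A ^+ i * P) = P.
  by rewrite -mulrA coreproj_powA drazinX_powA_cancel.
have PC : map_mx Num.conj P^T = P by rewrite defP; case: (mpinvP (A ^+ k)).
by apply: mpinv_unique; rewrite /is_mpinv !mulmxE AD DA coreproj_powA
     coreproj_drazinX.
Qed.

(** A matrix [Y] whose range lies in that of [A ^+ k.+1] is
    [D ^+ k.+1 * A ^+ k.+1 * Y], so it is determined by [A ^+ k.+1 * Y]. *)
Lemma coreinv_powA : coreinv (A ^+ k.+1) = D ^+ k.+1 * P.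
Proof.
have PE : rangeproj (A ^+ k.+1) = P by rewrite rangeproj_pow.
apply: xget_unique => [|Y] /=; rewrite /is_coreinv !mulmxE PE.
  split; first exact: powA_drazinX_cancel.
  by rewrite -(powA_drazinX_coreproj k.+1 k.+1) -mulmxE trmx_mul submxMl.
case=> <- /submxP[W /(canRL (@trmxK _ _ _)) ->].
by rewrite trmx_mul trmxK mulmxE !mulrA -comm_drazinX drazinX_powA.
Qed.

(** A group inverse [Y] of [B] has the same product with [B] as [E := D ^+ k]:
    [B Y = E B B Y = E B Y B = E B]. *)
Lemma groupinv_powA : groupinv (A ^+ k) = D ^+ k.
Proof.
have DAD : D ^+ k * A ^+ k * D ^+ k = D ^+ k.
  case: k => [|j]; first by rewrite !mulr1.
  by rewrite -comm_drazinX -mulrA -exprD powA_drazinX.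
have ADA : A ^+ k * D ^+ k * A ^+ k = A ^+ k by rewrite drazinX_powA.
apply: xget_unique => [|Y] /=; rewrite /is_groupinv !mulmxE.
  by split=> //; rewrite comm_drazinX.
set B := A ^+ k in DAD ADA *; set E := D ^+ k in DAD ADA *.
have BE : B * E = E * B by rewrite comm_drazinX.
case=> BYB YBY BY.
have YE : B * Y = B * E.
  by rewrite -{1}ADA BE -!mulrA BY (mulrA B) BYB.
by rewrite -YBY -BY YE BE -mulrA YE mulrA DAD.
Qed.

Lemma mxrank_pow_leq i j : (i <= j)%N -> (\rank (A ^+ j) <= \rank (A ^+ i))%N.
Proof. by move/subnKC <-; rewrite exprD -mulmxE mxrankM_maxl. Qed.

(** With [q] the index of [A ^+ m], the ranks of [A ^+ (m q)] and
    [A ^+ (m q + m)] are equal, and that of [A ^+ (m q + 1)] lies between. *)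
Lemma mxindex_pow_leq m : (0 < m)%N -> (k <= m * mxindex (A ^+ m))%N.
Proof.
move=> m_gt0; have := mxindex_rank (A ^+ m); rewrite -!exprM mulnS => rankE.
apply/mxindex_min/eqP; rewrite eqn_leq mxrank_pow_leq // -rankE.
by rewrite mxrank_pow_leq // -addn1 addnC leq_add2r.
Qed.

(** On matrices with range in that of [(A ^+ m) ^+ q], [D ^+ m] inverts
    [A ^+ m], hence coincides there with the Drazin inverse of [A ^+ m]. *)
Lemma cepinv_powA m : (0 < m)%N -> cepinv (A ^+ m) = D ^+ m * P.
Proof.
move=> m_gt0; set q := mxindex (A ^+ m); set E := drazin (A ^+ m).
have le_k : (k <= m * q)%N by apply: mxindex_pow_leq.
have [_ EC Eq] := drazinP (A ^+ m); rewrite -/E -/q !mulmxE in EC Eq.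
have EqD : E * A ^+ (m * q) = D ^+ m * A ^+ (m * q).
  have {1}<- := powA_mul_drazinX m le_k.
  have -> : A ^+ (m * q + m) = (A ^+ m) ^+ q.+1 by rewrite -exprM mulnS addnC.
  have -> : E * ((A ^+ m) ^+ q.+1 * D ^+ m) = (A ^+ m) ^+ q.+1 * E * D ^+ m.
    by rewrite mulrA; congr (_ * _); apply/commrX; rewrite /GRing.comm EC.
  by rewrite Eq -exprM comm_drazinX.
rewrite -(rangeproj_pow le_k) /cepinv -/q -/E -exprM !mulmxE EqD.
by rewrite -mulrA.
Qed.

Lemma wginv_powA m : (0 < m)%N -> wginv (A ^+ m) = D ^+ (m + m) * P * A ^+ m.
Proof.
move=> m_gt0; rewrite /wginv cepinv_powA // expr2 mulmxE -(mulrA _ P).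
by rewrite coreproj_drazinX mulrA -exprD.
Qed.

Lemma mwginvE m : mwginv m A = D ^+ m.+1 * P * A ^+ m.
Proof. by rewrite /mwginv cepinv_pow. Qed.

Local Notation PA := (rangeproj A).

(** The factor [W := D ^+ m.+1 * P * A ^+ m] satisfies [W A W = W] because
    [A ^+ m.+1] and [D ^+ m.+1] cancel in the middle, and the final projector
    is absorbed by [A].  Two solutions [X], [Y] of the defining equations
    satisfy [X = X A X = Y A X = Y A Y = Y]. *)
Lemma mwgmpinvE m : mwgmpinv m A = D ^+ m.+1 * P * A ^+ m * PA.
Proof.
have PAA : PA * A = A by apply: rangeproj_mul.
have PAE : PA = A * mpinv A by [].
set W := D ^+ m.+1 * P * A ^+ m.
have WAW : W * A * W = W.
  rewrite /W -(mulrA _ (A ^+ m) A) -exprSr.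
  rewrite -(mulrA _ (A ^+ m.+1)) (mulrA (A ^+ m.+1)) powA_drazinX_cancel.
  by rewrite mulrA -(mulrA _ P P) coreproj_idem.
have XAX : W * PA * A * (W * PA) = W * PA.
  by rewrite -(mulrA W) PAA mulrA WAW.
have AX : A * (W * PA) = A * W * A * mpinv A by rewrite PAE !mulrA.
have XA : W * PA * A = D * (A * W * A).
  have DAD : D * A * D ^+ m.+1 = D ^+ m.+1.
    rewrite -[D * A](comm_drazinX 1 1) -mulrA -exprS.
    exact: powA_drazinX 1 m.
  by rewrite -mulrA PAA /W !mulrA DAD.
apply: xget_unique => [|Y] /=; rewrite /is_mwgmpinv mwginvE !mulmxE -/W.
  by split.
rewrite -AX -XA => -[YAY AY YA].
by rewrite -YAY YA -mulrA AY mulrA XAX.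
Qed.

Lemma mwgmpinv_coreinv m : (m <= k)%N ->
  mwgmpinv m A = A ^+ (k - m) * coreinv (A ^+ k.+1) * A ^+ m * PA.
Proof.
move=> le_mk; rewrite mwgmpinvE coreinv_powA; do 2 congr (_ * _).
by rewrite -(powA_drazinX_coreproj (k - m)) addnS subnK.
Qed.

Lemma mwgmpinv_groupinv m : (m + 1 <= k)%N ->
  mwgmpinv m A = groupinv (A ^+ k) * A ^+ (k - m - 1) * P * A ^+ m * PA.
Proof.
move=> le_mk; rewrite mwgmpinvE groupinv_powA; do 2 congr (_ * _).
rewrite -comm_drazinX -mulrA -subnDA -(powA_drazinX_coreproj (k - (m + 1))).
by rewrite -(addn1 m) subnK.
Qed.

Lemma mwgmpinv_mpinv m :
  mwgmpinv m A = mpinv (A ^+ m.+1 * P) * A ^+ m * PA.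
Proof. by rewrite mwgmpinvE mpinv_powA_coreproj. Qed.

Lemma mwgmpinv_wginv m : (0 < m)%N ->
  mwgmpinv m A = A ^+ (m - 1) * P * wginv (A ^+ m) * PA.
Proof.
move=> m_gt0; rewrite mwgmpinvE wginv_powA //; congr (_ * _).
rewrite !mulrA; congr (_ * _).
rewrite -!mulrA coreproj_drazinX -(powA_drazinX_coreproj (m - 1)).
by rewrite addnS -addSn subn1 prednK.
Qed.

End CorePart.

(** * The representations *)

Local Open Scope complex_scope.

Theorem theorem5p1 (R : realType) (n : nat) (A : 'M[R[i]]_n) (k m : nat)
    (hk : mxindex A = k) (hm : (0 < m)%N) :
  [/\ mwgmpinv m A
        = drazin A ^+ m.+1 *m rangeproj (A ^+ k) *m A ^+ m *m rangeproj A,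
      (m <= k)%N ->
      mwgmpinv m A
        = A ^+ (k - m) *m coreinv (A ^+ k.+1) *m A ^+ m *m rangeproj A,
      (m + 1 <= k)%N ->
      mwgmpinv m A
        = groupinv (A ^+ k) *m A ^+ (k - m - 1) *m rangeproj (A ^+ k)
            *m A ^+ m *m rangeproj A,
      mwgmpinv m A
        = mpinv (A ^+ m.+1 *m rangeproj (A ^+ k)) *m A ^+ m *m rangeproj A
    & mwgmpinv m A
        = A ^+ (m - 1) *m rangeproj (A ^+ k) *m wginv (A ^+ m) *m rangeproj A].
Proof.
rewrite -hk; split.
- exact: mwgmpinvE.
- exact: mwgmpinv_coreinv.
- exact: mwgmpinv_groupinv.
- exact: mwgmpinv_mpinv.
- exact: mwgmpinv_wginv.
Qed.
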